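(* Let $X,Y$ be finite-dimensional locally finite simplicial complexes, each equipped with its standard metric. Then there exists $\epsilon(X,Y)>0$ such that the following holds for every $0<\epsilon<\epsilon(X,Y)$. If $f:X\to Y$ is a simplicial map that is an $\epsilon$-controlled homotopy equivalence $f:(X,f)\to (Y,\mathrm{id}_Y)$, then $f$ is homotopic to a map $f':X\to Y$ such that $f':(X,f')\to(Y,\mathrm{id}_Y)$ is a $Y$-triangular homotopy equivalence.
   Context: Standard metric: the standard $n$-simplex $\Delta^n\subset\mathbb{R}^{n+1}$ is the convex hull of the standard basis vectors $e_0,\dots,e_n$, with the metric induced from the Euclidean ($\ell_2$) metric. A locally finite finite-dimensional simplicial complex is given the path metric whose restriction to each $n$-simplex is this metric on $\Delta^n$ (points in different components have distance $\infty$). Controlled spaces: a space $X$ with a control map $p:X\to Y$ to a simplicial complex $Y$ is written $(X,p)$. A map $f:(X,p)\to(Z,q)$ is $Y$-triangular if $q(f(p^{-1}(\mathring\sigma)))\subset\sigma$ for every simplex $\sigma$ of $Y$ ($\mathring\sigma$ the open simplex). A homotopy $H:X\times[0,1]\to Z$ between maps $(X,p)\to(Z,q)$ is $Y$-triangular if $H:(X\times[0,1],p\circ \mathrm{pr}_1)\to(Z,q)$ is $Y$-triangular. A map $f:(X,p)\to(Z,q)$ is a $Y$-triangular homotopy equivalence if there are a map $g:Z\to X$ and homotopies $h_1:f\circ g\simeq\mathrm{id}_Z$, $h_2:g\circ f\simeq\mathrm{id}_X$ such that $f:(X,p)\to(Z,q)$, $g:(Z,q)\to(X,p)$, $h_1$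 (controlled via $q\circ\mathrm{pr}_1$) and $h_2$ (controlled via $p\circ\mathrm{pr}_1$) are all $Y$-triangular. If $Y$ carries a metric $d$, a map $f:(X,p)\to(Z,q)$ is $\epsilon$-controlled if $d(p(x),q(f(x)))<\epsilon$ for all $x\in X$; a homotopy is $\epsilon$-controlled if it is $\epsilon$-controlled as a map from $(X\times[0,1],p\circ\mathrm{pr}_1)$. A map $f:(X,p)\to(Z,q)$ is an $\epsilon$-controlled homotopy equivalence if there exist a homotopy inverse $g:Z\to X$ and homotopies $h_1:f\circ g\simeq \mathrm{id}_Z$, $h_2:g\circ f\simeq\mathrm{id}_X$ such that $f,g,h_1,h_2$ are all $\epsilon$-controlled. *)

(* Defs.v *)
From Stdlib Require Import Reals List ClassicalEpsilon.
Open Scope R_scope.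

(** * Abstract simplicial complexes on a vertex type V.
    A simplex is given by a (nonempty) list of its vertices; only the
    underlying vertex set matters (faces are closed under nonempty
    sub-collections, in particular under permutation / duplication).
    Every element of V is a vertex. *)
Record complex (V : Type) := {
  face : list V -> Prop;
  face_nonempty : forall s, face s -> s <> nil;
  face_vertex : forall v, face (v :: nil);
  face_sub : forall s t, face s -> t <> nil -> incl t s -> face t
}.

Arguments face {V} c _.

Definition finite_dim {V} (K : complex V) : Prop :=
  exists n : nat, forall s, face K s -> NoDup s -> (length s <= n)%nat.

Definition locally_finite {V} (K : complex V) : Prop :=
  forall v, exists L : list V, forall s, face K s -> In v s -> incl s L.

Definition lsum {A} (f : A -> R) (s : list A) : R := fold_right Rplus 0 (map f s).

Definition supp_in {V} (x : V -> R) (s : list V) : Prop :=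
  forall v, x v <> 0 -> In v s.

Definition carried {V} (K : complex V) (x : V -> R) (s : list V) : Prop :=
  face K s /\ NoDup s /\ (forall v, 0 <= x v) /\ supp_in x s /\ lsum x s = 1.

(** Points of the geometric realization |K| (barycentric coordinates). *)
Definition point {V} (K : complex V) : Type :=
  { x : V -> R | exists s, carried K x s }.

Definition coord {V} {K : complex V} (x : point K) : V -> R := proj1_sig x.

(** Euclidean (l2) distance of two points lying in the simplex s (NoDup s):
    this is the metric of the standard simplex (convex hull of the standard
    basis vectors in R^{|s|}). *)
Definition edist {V} (a b : V -> R) (s : list V) : R :=
  sqrt (lsum (fun v => (a v - b v) ^ 2) s).

Inductive chain {V} (K : complex V) : point K -> point K -> R -> Prop :=
| chain_refl (x : point K) : chain K x x 0
| chain_step (x y z : point K) (s : list V) (l : R) :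
    face K s -> NoDup s -> supp_in (coord x) s -> supp_in (coord y) s ->
    chain K y z l ->
    chain K x z (edist (coord x) (coord y) s + l).

(** Standard (path) metric: d(x,y) = inf of lengths of strings (= infinity
    if there is none); we only need the relation  d(x,y) < e. *)
Definition dist_lt {V} (K : complex V) (x y : point K) (e : R) : Prop :=
  exists l, chain K x y l /\ l < e.

Definition continuous {VA VB} {A : complex VA} {B : complex VB}
  (f : point A -> point B) : Prop :=
  forall x e, 0 < e -> exists d, 0 < d /\
    forall y, dist_lt A x y d -> dist_lt B (f x) (f y) e.

Definition I01 (t : R) : Prop := 0 <= t <= 1.

Definition homotopy {VA VB} {A : complex VA} {B : complex VB}
  (H : point A -> R -> point B) (f g : point A -> point B) : Prop :=
  (forall x t e, I01 t -> 0 < e -> exists d, 0 < d /\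
     forall y u, I01 u -> dist_lt A x y d -> Rabs (t - u) < d ->
       dist_lt B (H x t) (H y u) e) /\
  (forall x, H x 0 = f x) /\ (forall x, H x 1 = g x).

Definition homotopic {VA VB} {A : complex VA} {B : complex VB}
  (f g : point A -> point B) : Prop :=
  exists H, homotopy H f g.

Definition ind {V W} (phi : V -> W) (w : W) (v : V) : R :=
  if excluded_middle_informative (phi v = w) then 1 else 0.

Definition simplicial {VA VB} {A : complex VA} {B : complex VB}
  (f : point A -> point B) : Prop :=
  exists phi : VA -> VB,
    (forall s, face A s -> exists t, face B t /\ incl (map phi s) t) /\
    (forall (x : point A) s, carried A (coord x) s ->
       forall w, coord (f x) w = lsum (fun v => ind phi w v * coord x v) s).

Definition in_open_simplex {V} (K : complex V) (y : point K) (s : list V) : Prop :=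
  forall v, In v s <-> coord y v <> 0.
Definition in_closed_simplex {V} (K : complex V) (y : point K) (s : list V) : Prop :=
  supp_in (coord y) s.

Section Control.
Context {VA VB VY : Type} {A : complex VA} {B : complex VB} {Y : complex VY}.

Definition triangular (p : point A -> point Y) (q : point B -> point Y)
  (f : point A -> point B) : Prop :=
  forall s, face Y s -> NoDup s -> forall a,
    in_open_simplex Y (p a) s -> in_closed_simplex Y (q (f a)) s.

Definition htriangular (p : point A -> point Y) (q : point B -> point Y)
  (H : point A -> R -> point B) : Prop :=
  forall s, face Y s -> NoDup s -> forall a t, I01 t ->
    in_open_simplex Y (p a) s -> in_closed_simplex Y (q (H a t)) s.

Definition controlled (p : point A -> point Y) (q : point B -> point Y)
  (f : point A -> point B) (e : R) : Prop :=
  forall a, dist_lt Y (p a) (q (f a)) e.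

Definition hcontrolled (p : point A -> point Y) (q : point B -> point Y)
  (H : point A -> R -> point B) (e : R) : Prop :=
  forall a t, I01 t -> dist_lt Y (p a) (q (H a t)) e.
End Control.

Definition triangular_he {VA VB VY} {A : complex VA} {B : complex VB}
  (Y : complex VY) (p : point A -> point Y) (q : point B -> point Y)
  (f : point A -> point B) : Prop :=
  continuous f /\
  exists (g : point B -> point A) (h1 : point B -> R -> point B)
         (h2 : point A -> R -> point A),
    continuous g /\
    homotopy h1 (fun b => f (g b)) (fun b => b) /\
    homotopy h2 (fun a => g (f a)) (fun a => a) /\
    triangular p q f /\ triangular q p g /\
    htriangular q q h1 /\ htriangular p p h2.

Definition controlled_he {VA VB VY} {A : complex VA} {B : complex VB}
  (Y : complex VY) (p : point A -> point Y) (q : point B -> point Y)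
  (f : point A -> point B) (e : R) : Prop :=
  continuous f /\
  exists (g : point B -> point A) (h1 : point B -> R -> point B)
         (h2 : point A -> R -> point A),
    continuous g /\
    homotopy h1 (fun b => f (g b)) (fun b => b) /\
    homotopy h2 (fun a => g (f a)) (fun a => a) /\
    controlled p q f e /\ controlled q p g e /\
    hcontrolled q q h1 e /\ hcontrolled p p h2 e.

(* Main.v *)
(* Let [d = 1 / (2m)], where [m] bounds the number of vertices of a simplex of
   [Y], and let [r_t : Y -> Y] multiply each barycentric coordinate [c] by
   [(1 - t) + t max(0, c - d)] and renormalize.  Then [r_0 = id], every [r_t]
   preserves closed simplices, and [r_1] kills exactly the coordinates that are
   at most [d], so it maps the [d]-neighbourhood of a simplex into it.  As [f] is
   simplicial, the same rescaling on [X], with weights read off from [f x],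
   gives [R_t : X -> X] with [f R_t = r_t f].  Take [f' = r_1 f], with the given
   [g] as inverse.  The homotopies are [r_1 h1] followed by [r_t], and [h2 R_1]
   (which starts at [g f R_1 = g f']) followed by [R_t]; they are triangular
   because a [d]-controlled motion becomes triangular after applying [r_1], and
   because [r_t] does not increase coordinates that are at most [d]. *)

From Stdlib Require Import Reals List Lra Lia ClassicalEpsilon.
From Stdlib Require Import FunctionalExtensionality ProofIrrelevance.
Require Import Defs.
Open Scope R_scope.

(** * Finite sums over lists of vertices *)

Lemma Rabs_le_inv a b : Rabs a <= b -> - b <= a <= b.
Proof.
  pose proof (Rle_abs a). pose proof (Rle_abs (- a)).
  rewrite Rabs_Ropp in *. lra.
Qed.

Lemma lsum_ext {A} (f g : A -> R) s :
  (forall a, In a s -> f a = g a) -> lsum f s = lsum g s.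
Proof.
  unfold lsum. intros H. f_equal. now apply map_ext_in.
Qed.

Lemma lsum_plus {A} (f g : A -> R) s :
  lsum (fun a => f a + g a) s = lsum f s + lsum g s.
Proof. induction s as [|a s IH]; cbn; [lra|]. fold (lsum (fun a => f a + g a) s).
  rewrite IH. unfold lsum. lra. Qed.

Lemma lsum_scal {A} c (f : A -> R) s :
  lsum (fun a => c * f a) s = c * lsum f s.
Proof. induction s as [|a s IH]; cbn; [lra|]. fold (lsum (fun a => c * f a) s).
  rewrite IH. unfold lsum. lra. Qed.

Lemma lsum_le {A} (f g : A -> R) s :
  (forall a, In a s -> f a <= g a) -> lsum f s <= lsum g s.
Proof.
  induction s as [|a s IH]; intros H; [apply Rle_refl|].
  apply Rplus_le_compat; [apply H; now left|].
  apply IH. intros b Hb; apply H; now right.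
Qed.

Lemma lsum_const {A} c (s : list A) : lsum (fun _ => c) s = INR (length s) * c.
Proof.
  induction s as [|a s IH]; [cbn; lra|].
  change (c + lsum (fun _ : A => c) s = INR (S (length s)) * c).
  rewrite IH, S_INR. lra.
Qed.

Lemma lsum_nonneg {A} (f : A -> R) s :
  (forall a, In a s -> 0 <= f a) -> 0 <= lsum f s.
Proof.
  intros H. apply Rle_trans with (lsum (fun _ => 0) s).
  - rewrite lsum_const; lra.
  - now apply lsum_le.
Qed.

Lemma lsum_ge_term {A} (f : A -> R) s a :
  (forall b, In b s -> 0 <= f b) -> In a s -> f a <= lsum f s.
Proof.
  induction s as [|b s IH]; intros H Ha; [easy|].
  change (f a <= f b + lsum f s).
  assert (Hs : forall c, In c s -> 0 <= f c) by (intros; apply H; now right).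
  destruct Ha as [->|Ha].
  - pose proof (lsum_nonneg f s Hs). lra.
  - pose proof (IH Hs Ha). pose proof (H b (or_introl eq_refl)). lra.
Qed.

Lemma lsum_dist_le {A} (f g : A -> R) c s :
  (forall a, In a s -> Rabs (f a - g a) <= c) ->
  Rabs (lsum f s - lsum g s) <= INR (length s) * c.
Proof.
  intros H. rewrite <- lsum_const.
  assert (H1 : lsum f s <= lsum (fun a => g a + c) s).
  { apply lsum_le. intros a Ha. specialize (H a Ha).
    apply Rabs_le_inv in H. lra. }
  assert (H2 : lsum g s <= lsum (fun a => f a + c) s).
  { apply lsum_le. intros a Ha. specialize (H a Ha).
    apply Rabs_le_inv in H. lra. }
  rewrite lsum_plus in H1, H2. apply Rabs_le. lra.
Qed.

Lemma lsum_swap {A B} (F : A -> B -> R) s t :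
  lsum (fun a => lsum (F a) t) s = lsum (fun b => lsum (fun a => F a b) s) t.
Proof.
  induction s as [|a s IH].
  - change (0 = lsum (fun _ : B => 0) t). rewrite lsum_const; lra.
  - change (lsum (F a) t + lsum (fun a => lsum (F a) t) s
      = lsum (fun b => F a b + lsum (fun a => F a b) s) t).
    now rewrite lsum_plus, IH.
Qed.

Lemma ind_cases {V W} (phi : V -> W) w v :
  (phi v = w /\ ind phi w v = 1) \/ (phi v <> w /\ ind phi w v = 0).
Proof.
  unfold ind. destruct (excluded_middle_informative (phi v = w)); auto.
Qed.

(** Only the term at [w = phi v] can survive. If [phi v] is missing from [t], the second hypothesis
    makes [K (phi v)] vanish, so both sides are 0. *)
Lemma lsum_ind {V W} (phi : V -> W) v (K : W -> R) t :
  NoDup t -> (K (phi v) <> 0 -> In (phi v) t) ->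
  lsum (fun w => ind phi w v * K w) t = K (phi v).
Proof.
  assert (Hout : forall t, ~ In (phi v) t ->
    lsum (fun w => ind phi w v * K w) t = 0).
  { intros t' Ht. rewrite (lsum_ext _ (fun _ => 0)).
    - rewrite lsum_const; lra.
    - intros w Hw. destruct (ind_cases phi w v) as [[E _]|[_ ->]]; [|lra].
      subst w; contradiction. }
  intros Hnd Hin.
  destruct (excluded_middle_informative (In (phi v) t)) as [H|H].
  - clear Hin. induction Hnd as [|w t Hw Hnd IH]; [easy|].
    change (ind phi w v * K w + lsum (fun w => ind phi w v * K w) t = K (phi v)).
    destruct (ind_cases phi w v) as [[E ->]|[E ->]].
    + subst w. rewrite Hout by assumption. lra.
    + rewrite IH; [lra|]. destruct H as [->|H]; [easy|exact H].
  - rewrite Hout by assumption.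
    destruct (Req_dec (K (phi v)) 0) as [->|Hne]; [reflexivity|].
    now destruct (H (Hin Hne)).
Qed.

Lemma ind_id_sym {V} (v w : V) : ind (fun u => u) w v = ind (fun u => u) v w.
Proof.
  destruct (ind_cases (fun u : V => u) w v) as [[E ->]|[E ->]];
  destruct (ind_cases (fun u : V => u) v w) as [[E' ->]|[E' ->]]; congruence.
Qed.

(** Expanding [g] with a Kronecker delta and swapping the two sums replaces any argument about
    permutations of lists. It makes barycentric sums independent of the simplex used to carry a
    point. *)
Lemma lsum_supp {V} (g : V -> R) s t :
  NoDup s -> NoDup t -> supp_in g s -> supp_in g t -> lsum g s = lsum g t.
Proof.
  intros Hs Ht Gs Gt.
  transitivity
    (lsum (fun v => lsum (fun w => ind (fun u => u) w v * g w) t) s).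
  - apply lsum_ext. intros v _. symmetry.
    exact (lsum_ind (fun u => u) v g t Ht (Gt v)).
  - rewrite lsum_swap. apply lsum_ext. intros w _.
    rewrite (lsum_ext _ (fun v => ind (fun u => u) v w * g v)).
    + exact (lsum_ind (fun u => u) w g s Hs (Gs w)).
    + intros v _. rewrite (ind_id_sym v w).
      destruct (ind_cases (fun u : V => u) v w) as [[-> _]|[_ ->]]; [reflexivity|lra].
Qed.

(** * Barycentric coordinates and the path metric *)

Lemma point_ext {V} {K : complex V} (x y : point K) :
  (forall v, coord x v = coord y v) -> x = y.
Proof.
  intros H. destruct x as [x Hx], y as [y Hy]. cbn in H.
  assert (x = y) by now apply functional_extensionality. subst y.
  f_equal. apply proof_irrelevance.
Qed.

Lemma coord_nonneg {V} {K : complex V} (x : point K) v : 0 <= coord x v.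
Proof. destruct x as [x [s Hs]]. apply Hs. Qed.

Lemma coord_le1 {V} {K : complex V} (x : point K) v : coord x v <= 1.
Proof.
  pose proof (coord_nonneg x) as Hx.
  destruct (proj2_sig x) as [s (_ & _ & _ & Hsupp & Hsum)].
  change (proj1_sig x) with (coord x) in *. rewrite <- Hsum.
  destruct (Req_dec (coord x v) 0) as [E|E].
  - rewrite E. now apply lsum_nonneg.
  - apply lsum_ge_term; auto.
Qed.

Lemma carried_intro {V} (K : complex V) (x : point K) s :
  face K s -> NoDup s -> supp_in (coord x) s -> carried K (coord x) s.
Proof.
  intros Hf Hnd Hs.
  destruct (proj2_sig x) as [t (_ & Hnt & _ & Ht & Hsum)].
  repeat split; auto using coord_nonneg.
  rewrite <- Hsum. now apply lsum_supp.
Qed.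

Lemma coord_le_edist {V} (a b : V -> R) s v :
  supp_in a s -> supp_in b s -> Rabs (a v - b v) <= edist a b s.
Proof.
  intros Ha Hb. unfold edist.
  destruct (excluded_middle_informative (In v s)) as [H|H].
  - rewrite <- sqrt_Rsqr_abs. apply sqrt_le_1_alt.
    replace (Rsqr (a v - b v)) with ((a v - b v) ^ 2) by (unfold Rsqr; ring).
    apply (lsum_ge_term (fun v => (a v - b v) ^ 2)); [|exact H].
    intros; apply pow2_ge_0.
  - destruct (Req_dec (a v) 0) as [Ea|Ea]; [|now destruct (H (Ha v Ea))].
    destruct (Req_dec (b v) 0) as [Eb|Eb]; [|now destruct (H (Hb v Eb))].
    rewrite Ea, Eb, Rminus_diag, Rabs_R0. apply sqrt_pos.
Qed.

(** With [N] terms the sum of squares is at most [N * c ^ 2], hence at most [(N * c) ^ 2] because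
    [N] is 0 or at least 1. This crude factor suffices, since [N] will be bounded by the
    dimension. *)
Lemma edist_le {V} (a b : V -> R) s c :
  0 <= c -> (forall v, In v s -> Rabs (a v - b v) <= c) ->
  edist a b s <= INR (length s) * c.
Proof.
  intros Hc H. unfold edist.
  assert (H0 : 0 <= INR (length s) * c)
    by (apply Rmult_le_pos; [apply pos_INR|exact Hc]).
  rewrite <- (sqrt_pow2 (INR (length s) * c)) by exact H0.
  apply sqrt_le_1_alt.
  apply Rle_trans with (lsum (fun _ => c ^ 2) s).
  - apply lsum_le. intros v Hv. rewrite <- (pow2_abs (a v - b v)).
    apply pow_incr. split; [apply Rabs_pos|auto].
  - rewrite lsum_const. destruct s as [|v s]; [cbn; lra|].
    assert (1 <= INR (length (v :: s))).
    { change (length (v :: s)) with (S (length s)). rewrite S_INR.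
      pose proof (pos_INR (length s)). lra. }
    assert (0 <= c ^ 2) by apply pow2_ge_0. nra.
Qed.

(** A coordinate changes along each link of a chain by at most the length of that link. This turns
    metric control into control of single coordinates. *)
Lemma coord_dist_lt {V} {K : complex V} (x y : point K) e v :
  dist_lt K x y e -> Rabs (coord x v - coord y v) < e.
Proof.
  intros (l & Hc & Hl). apply Rle_lt_trans with l; [|exact Hl]. clear e Hl.
  induction Hc as [x|x y z s l Hf Hnd Hx Hy Hc IH].
  - rewrite Rminus_diag, Rabs_R0. lra.
  - pose proof (coord_le_edist _ _ _ v Hx Hy).
    replace (coord x v - coord z v)
      with ((coord x v - coord y v) + (coord y v - coord z v)) by ring.
    eapply Rle_trans; [apply Rabs_triang|]. lra.
Qed.

Lemma positive_coord_bound {V} {K : complex V} (x : point K) :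
  exists m, 0 < m /\ forall v, coord x v <> 0 -> m <= coord x v.
Proof.
  destruct (proj2_sig x) as [s (_ & _ & _ & Hs & _)].
  change (proj1_sig x) with (coord x) in Hs.
  assert (H : exists m, 0 < m /\
    forall v, In v s -> coord x v <> 0 -> m <= coord x v).
  { clear Hs. induction s as [|w s (m & Hm & IH)].
    - exists 1. split; [lra|easy].
    - destruct (Req_dec (coord x w) 0) as [E|E].
      + exists m. split; [exact Hm|]. intros v [<-|Hv]; [easy|auto].
      + pose proof (coord_nonneg x w).
        exists (Rmin m (coord x w)). split; [apply Rmin_glb_lt; lra|].
        intros v [<-|Hv] Hne; [apply Rmin_r|].
        eapply Rle_trans; [apply Rmin_l|auto]. }
  destruct H as (m & Hm & H). exists m. auto.
Qed.

(** Within the smallest positive coordinate of [x], no positive coordinate of [x] can drop to 0.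
    Continuity at [x] thus reduces to estimates inside one simplex containing both points. *)
Lemma nearby_carried {V} {K : complex V} (x : point K) :
  exists d, 0 < d /\ forall y, dist_lt K x y d ->
    forall s, carried K (coord y) s -> carried K (coord x) s.
Proof.
  destruct (positive_coord_bound x) as (m & Hm & H).
  exists m. split; [exact Hm|]. intros y Hd s (Hf & Hnd & _ & Hs & _).
  apply carried_intro; auto. intros v Hv. apply Hs. intros E.
  pose proof (coord_dist_lt _ _ _ v Hd) as Hlt. specialize (H v Hv).
  rewrite E, Rminus_0_r, Rabs_pos_eq in Hlt by lra. lra.
Qed.

Lemma carried_dist_lt {V} {K : complex V} (x y : point K) s c e :
  face K s -> NoDup s -> supp_in (coord x) s -> supp_in (coord y) s ->
  0 <= c -> (forall v, Rabs (coord x v - coord y v) <= c) ->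
  INR (length s) * c < e -> dist_lt K x y e.
Proof.
  intros Hf Hnd Hx Hy Hc H He.
  exists (edist (coord x) (coord y) s + 0). split.
  - apply chain_step; auto. apply chain_refl.
  - pose proof (edist_le (coord x) (coord y) s c Hc (fun v _ => H v)). lra.
Qed.

(** * Composition, reversal and concatenation of homotopies *)

Section Homotopies.
Context {VA VB VC : Type} {A : complex VA} {B : complex VB} {C : complex VC}.

Lemma continuous_comp (f : point A -> point B) (g : point B -> point C) :
  continuous f -> continuous g -> continuous (fun x => g (f x)).
Proof.
  intros Hf Hg x e He. destruct (Hg (f x) e He) as (d & Hd & H).
  destruct (Hf x d Hd) as (d' & Hd' & H'). exists d'. auto.
Qed.

Lemma homotopy_postcomp H (f f' : point A -> point B) (g : point B -> point C) :
  homotopy H f f' -> continuous g ->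
  homotopy (fun x t => g (H x t)) (fun x => g (f x)) (fun x => g (f' x)).
Proof.
  intros (Hc & H0 & H1) Hg. split; [|split; intros; congruence].
  intros x t e Ht He. destruct (Hg (H x t) e He) as (d & Hd & Hd').
  destruct (Hc x t d Ht Hd) as (d2 & Hd2 & H2). exists d2. auto.
Qed.

Lemma homotopy_precomp H (f : point A -> point B) (g g' : point B -> point C) :
  homotopy H g g' -> continuous f ->
  homotopy (fun x t => H (f x) t) (fun x => g (f x)) (fun x => g' (f x)).
Proof.
  intros (Hc & H0 & H1) Hf. split; [|split; intros; congruence].
  intros x t e Ht He. destruct (Hc (f x) t e Ht He) as (d & Hd & Hd').
  destruct (Hf x d Hd) as (d2 & Hd2 & H2).
  exists (Rmin d d2). split; [now apply Rmin_glb_lt|].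
  intros y u Hu (l & Hl & Hlt) Htu.
  pose proof (Rmin_l d d2). pose proof (Rmin_r d d2).
  apply Hd'; [exact Hu| |lra]. apply H2. exists l. split; [exact Hl|lra].
Qed.

Lemma homotopy_rev H (f g : point A -> point B) :
  homotopy H f g -> homotopy (fun x t => H x (1 - t)) g f.
Proof.
  intros (Hc & H0 & H1). split; [|split].
  - intros x t e Ht He. unfold I01 in *.
    destruct (Hc x (1 - t) e) as (d & Hd & H'); [unfold I01; lra|exact He|].
    exists d. split; [exact Hd|]. intros y u Hu Hxy Htu.
    apply H'; [unfold I01; lra|exact Hxy|].
    replace (1 - t - (1 - u)) with (- (t - u)) by ring. now rewrite Rabs_Ropp.
  - intros x. now rewrite Rminus_0_r.
  - intros x. now rewrite Rminus_diag.
Qed.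

Lemma homotopy_end H (f g : point A -> point B) : homotopy H f g -> continuous g.
Proof.
  intros (Hc & _ & H1) x e He.
  destruct (Hc x 1 e) as (d & Hd & H'); [unfold I01; lra|exact He|].
  exists d. split; [exact Hd|]. intros y Hxy. rewrite <- !H1.
  apply H'; [unfold I01; lra|exact Hxy|]. now rewrite Rminus_diag, Rabs_R0.
Qed.

Definition concat (H H' : point A -> R -> point B) : point A -> R -> point B :=
  fun x t => if Rle_dec t (1 / 2) then H x (2 * t) else H' x (2 * t - 1).

Lemma homotopy_concat H H' (f g h : point A -> point B) :
  homotopy H f g -> homotopy H' g h -> homotopy (concat H H') f h.
Proof.
  intros (Hc & H0 & H1) (Hc' & H0' & H1'). unfold concat. split; [|split].
  - intros x t e Ht He. unfold I01 in *.
    (* [L] and [U] give continuity on the two closed halves. The tolerance is halved because time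
       runs twice as fast there. *)
    assert (L : t <= 1 / 2 -> exists d, 0 < d /\ forall y u, I01 u ->
      dist_lt A x y d -> Rabs (t - u) < d -> u <= 1 / 2 ->
      dist_lt B (H x (2 * t)) (H y (2 * u)) e).
    { intros Hh. destruct (Hc x (2 * t) e) as (d & Hd & HH);
        [unfold I01; lra|exact He|].
      exists (d / 2). split; [lra|]. intros y u Hu (l & Hl & Hll) Htu Huh.
      unfold I01 in Hu. apply HH; [unfold I01; lra| |].
      - exists l. split; [exact Hl|lra].
      - apply Rabs_def2 in Htu. apply Rabs_def1; lra. }
    assert (U : 1 / 2 <= t -> exists d, 0 < d /\ forall y u, I01 u ->
      dist_lt A x y d -> Rabs (t - u) < d -> 1 / 2 <= u ->
      dist_lt B (H' x (2 * t - 1)) (H' y (2 * u - 1)) e).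
    { intros Hh. destruct (Hc' x (2 * t - 1) e) as (d & Hd & HH);
        [unfold I01; lra|exact He|].
      exists (d / 2). split; [lra|]. intros y u Hu (l & Hl & Hll) Htu Huh.
      unfold I01 in Hu. apply HH; [unfold I01; lra| |].
      - exists l. split; [exact Hl|lra].
      - apply Rabs_def2 in Htu. apply Rabs_def1; lra. }
    destruct (Rtotal_order t (1 / 2)) as [Hlt|[Heq|Hgt]].
    + destruct (L (Rlt_le _ _ Hlt)) as (d & Hd & HH).
      (* Away from [1 / 2] the tolerance is cut so that [u] stays on the same side as [t]. *)
      exists (Rmin d (1 / 2 - t)). split; [apply Rmin_glb_lt; lra|].
      intros y u Hu (l & Hl & Hll) Htu.
      pose proof (Rmin_l d (1 / 2 - t)). pose proof (Rmin_r d (1 / 2 - t)).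
      pose proof (Rabs_def2 _ _ Htu).
      destruct (Rle_dec t (1 / 2)); [|lra]. destruct (Rle_dec u (1 / 2)); [|lra].
      apply HH; auto; [|lra]. exists l; split; [exact Hl|lra].
    + destruct (L (Req_le _ _ Heq)) as (d & Hd & HH).
      destruct (U (Req_le_sym _ _ Heq)) as (d' & Hd' & HH').
      exists (Rmin d d'). split; [now apply Rmin_glb_lt|].
      intros y u Hu (l & Hl & Hll) Htu.
      pose proof (Rmin_l d d'). pose proof (Rmin_r d d').
      destruct (Rle_dec t (1 / 2)); [|lra]. destruct (Rle_dec u (1 / 2)).
      * apply HH; auto; [|lra]. exists l; split; [exact Hl|lra].
      (* At [t = 1 / 2] both halves take the value [g x], so the second one may be used for [u]
         beyond it. *)
      * replace (H x (2 * t)) with (H' x (2 * t - 1)).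
        -- apply HH'; [exact Hu| |lra|lra]. exists l; split; [exact Hl|lra].
        -- replace (2 * t - 1) with 0 by lra. replace (2 * t) with 1 by lra.
           now rewrite H0', H1.
    + destruct (U (Rlt_le _ _ Hgt)) as (d & Hd & HH).
      exists (Rmin d (t - 1 / 2)). split; [apply Rmin_glb_lt; lra|].
      intros y u Hu (l & Hl & Hll) Htu.
      pose proof (Rmin_l d (t - 1 / 2)). pose proof (Rmin_r d (t - 1 / 2)).
      pose proof (Rabs_def2 _ _ Htu).
      destruct (Rle_dec t (1 / 2)); [lra|]. destruct (Rle_dec u (1 / 2)); [lra|].
      apply HH; auto; [|lra|lra]. exists l; split; [exact Hl|lra].
  - intros x. destruct (Rle_dec 0 (1 / 2)); [|lra]. now rewrite Rmult_0_r.
  - intros x. destruct (Rle_dec 1 (1 / 2)); [lra|].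
    replace (2 * 1 - 1) with 1 by ring. apply H1'.
Qed.

Lemma concat_ind (P : point A -> point B -> Prop) H H' :
  (forall x t, I01 t -> P x (H x t)) -> (forall x t, I01 t -> P x (H' x t)) ->
  forall x t, I01 t -> P x (concat H H' x t).
Proof.
  unfold concat, I01. intros HP HP' x t Ht.
  destruct (Rle_dec t (1 / 2)); [apply HP|apply HP']; lra.
Qed.
End Homotopies.

(** * Estimates for the weights and for quotients *)

Definition wt (d t c : R) : R := (1 - t) + t * Rmax 0 (c - d).

Lemma wt_ge d t c : I01 t -> 1 - t <= wt d t c.
Proof. unfold wt, I01. intros Ht. pose proof (Rmax_l 0 (c - d)). nra. Qed.

Lemma wt_nonneg d t c : I01 t -> 0 <= wt d t c.
Proof. intros Ht. pose proof (wt_ge d t c Ht). unfold I01 in Ht. lra. Qed.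

Lemma wt_le1 d t c : I01 t -> 0 <= d -> c <= 1 -> wt d t c <= 1.
Proof.
  unfold wt, I01. intros Ht Hd Hc.
  assert (Rmax 0 (c - d) <= 1) by (apply Rmax_lub; lra). nra.
Qed.

Lemma wt_small d t c : c <= d -> wt d t c = 1 - t.
Proof. unfold wt. intros H. rewrite Rmax_left; lra. Qed.

(** The difference splits into a change of time, multiplied by a factor of absolute value at most 1,
    and [u] times a change of the truncation, which is 1-Lipschitz in [c]. *)
Lemma wt_lipschitz d t u c c' a b :
  I01 t -> I01 u -> 0 <= d -> 0 <= c <= 1 ->
  Rabs (t - u) <= a -> Rabs (c - c') <= b ->
  Rabs (wt d t c - wt d u c') <= a + b.
Proof.
  unfold wt, I01. intros Ht Hu Hd Hc Ha Hb.
  assert (M : Rabs (Rmax 0 (c - d) - Rmax 0 (c' - d)) <= b).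
  { apply Rabs_le_inv in Hb. apply Rabs_le.
    unfold Rmax. destruct (Rle_dec 0 (c - d)), (Rle_dec 0 (c' - d)); lra. }
  assert (0 <= Rmax 0 (c - d) <= 1) by (split; [apply Rmax_l|apply Rmax_lub; lra]).
  replace (1 - t + t * Rmax 0 (c - d) - (1 - u + u * Rmax 0 (c' - d)))
    with ((t - u) * (Rmax 0 (c - d) - 1)
      + u * (Rmax 0 (c - d) - Rmax 0 (c' - d))) by ring.
  eapply Rle_trans; [apply Rabs_triang|]. rewrite !Rabs_mult.
  rewrite (Rabs_pos_eq u) by lra.
  assert (Rabs (Rmax 0 (c - d) - 1) <= 1) by (apply Rabs_le; lra).
  pose proof (Rabs_pos (t - u)). pose proof (Rabs_pos (Rmax 0 (c - d) - 1)).
  pose proof (Rabs_pos (Rmax 0 (c - d) - Rmax 0 (c' - d))).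
  apply Rplus_le_compat; nra.
Qed.

(** With [r = p' / q'] in [0, 1], the difference equals [((p - p') - r * (q - q')) / q], so the
    quantitative lower bound is required of [q] alone. *)
Lemma quotient_dist p q p' q' c a b :
  0 < c -> c <= q -> 0 <= p' <= q' -> 0 < q' ->
  Rabs (p - p') <= a -> Rabs (q - q') <= b ->
  Rabs (p / q - p' / q') <= (a + b) / c.
Proof.
  intros Hc Hq Hp' Hq' Ha Hb.
  assert (Hr : 0 <= p' / q' <= 1).
  { split; [apply Rle_mult_inv_pos; lra|].
    apply Rmult_le_reg_r with q'; [exact Hq'|]. unfold Rdiv.
    rewrite Rmult_assoc, Rinv_l by lra. lra. }
  set (r := p' / q') in *.
  replace (p / q - r) with (((p - p') - r * (q - q')) / q)
    by (unfold r; field; lra).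
  unfold Rdiv. rewrite Rabs_mult, (Rabs_pos_eq (/ q))
    by (left; apply Rinv_0_lt_compat; lra).
  apply Rmult_le_compat.
  - apply Rabs_pos.
  - left; apply Rinv_0_lt_compat; lra.
  - eapply Rle_trans; [apply Rabs_triang|]. rewrite Rabs_Ropp, Rabs_mult.
    rewrite (Rabs_pos_eq r) by lra.
    pose proof (Rabs_pos (q - q')). nra.
  - apply Rinv_le_contravar; lra.
Qed.

(** * The squeezing homotopy on the source of a simplicial map *)

Definition simplicial_via {VA VB} {A : complex VA} {B : complex VB}
  (phi : VA -> VB) (f : point A -> point B) : Prop :=
  forall (x : point A) s, carried A (coord x) s ->
    forall w, coord (f x) w = lsum (fun v => ind phi w v * coord x v) s.

(** Makes the squeezing of [Y] itself an instance of the general construction, with [phi] the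
    identity. *)
Lemma simplicial_via_id {V} (K : complex V) :
  simplicial_via (A := K) (fun v => v) (fun x => x).
Proof.
  intros x s (_ & Hnd & _ & Hs & _) w.
  rewrite (lsum_ext _ (fun v => ind (fun u => u) v w * coord x v)).
  - symmetry. exact (lsum_ind (fun u => u) w (coord x) s Hnd (Hs w)).
  - intros v _. now rewrite ind_id_sym.
Qed.

(** Stated as a relation, since the points are later obtained by choice. Quantifying over every
    carrier [s] lets the formula be evaluated in whichever simplex is convenient. *)
Definition squeezes {VA VB} {A : complex VA} {B : complex VB}
  (phi : VA -> VB) (f : point A -> point B) (d : R)
  (S : point A -> R -> point A) : Prop :=
  forall x t s, I01 t -> carried A (coord x) s -> forall v,
    coord (S x t) v = coord x v * wt d t (coord (f x) (phi v)) /
      lsum (fun u => coord x u * wt d t (coord (f x) (phi u))) s.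

Section Squeeze.
Context {VA VB : Type} {A : complex VA} {B : complex VB}.
Variables (phi : VA -> VB) (f : point A -> point B).
Hypothesis Hf : simplicial_via phi f.

(** Change of variables for the pushforward of barycentric coordinates: [v] is grouped by its image
    [w]. *)
Lemma lsum_push x s t (K : VB -> R) :
  carried A (coord x) s -> carried B (coord (f x)) t ->
  lsum (fun v => coord x v * K (phi v)) s = lsum (fun w => coord (f x) w * K w) t.
Proof.
  intros Hs (_ & Hnt & _ & Ht & _).
  transitivity
    (lsum (fun v => lsum (fun w => ind phi w v * (coord x v * K w)) t) s).
  - apply lsum_ext. intros v Hv. symmetry.
    apply (lsum_ind phi v (fun w => coord x v * K w) t Hnt).
    (* By nonnegativity, the coordinate of [f x] at [phi v] is at least [coord x v], so it cannot
       vanish when [coord x v] is positive. *)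
    intros Hne. apply Ht. rewrite (Hf x s Hs). intros E.
    assert (Hle : ind phi (phi v) v * coord x v <= 0).
    { rewrite <- E. apply (lsum_ge_term (fun u => ind phi (phi v) u * coord x u));
        [|exact Hv].
      intros u _. pose proof (coord_nonneg x u).
      destruct (ind_cases phi (phi v) u) as [[_ ->]|[_ ->]]; lra. }
    destruct (ind_cases phi (phi v) v) as [[_ E1]|[N _]]; [|easy].
    rewrite E1 in Hle. pose proof (coord_nonneg x v).
    apply Hne. replace (coord x v) with 0 by lra. ring.
  - rewrite lsum_swap. apply lsum_ext. intros w _.
    rewrite (Hf x s Hs), Rmult_comm, <- lsum_scal.
    apply lsum_ext. intros; ring.
Qed.

Variables (n m : R).
Hypothesis Hn : forall s, face A s -> NoDup s -> INR (length s) <= n.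
Hypothesis Hm : forall s, face B s -> NoDup s -> INR (length s) <= m.
Hypothesis m_ge1 : 1 <= m.
Let d := / (2 * m).

Lemma d_pos : 0 < d.
Proof. apply Rinv_0_lt_compat. lra. Qed.

Lemma dm : d * m = / 2.
Proof. unfold d. field. lra. Qed.

(* Since [f x] has at most [m] nonzero coordinates, its sum of squares is at
   least [1 / m]; here in the tangent line form [y^2 >= 2y/m - 1/m^2]. *)
Lemma mass_ge x s t : I01 t -> carried A (coord x) s ->
  d <= lsum (fun v => coord x v * wt d t (coord (f x) (phi v))) s.
Proof.
  intros Ht Hs. destruct (proj2_sig (f x)) as [s' Hs'].
  change (proj1_sig (f x)) with (coord (f x)) in Hs'.
  rewrite (lsum_push x s s' (fun w => wt d t (coord (f x) w)) Hs Hs').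
  destruct Hs' as (Hfs & Hnd & _ & _ & Hsum).
  pose proof d_pos as Hd. pose proof dm as Hdm. pose proof (Hm _ Hfs Hnd) as Hl.
  apply Rle_trans with (lsum (fun w =>
    ((1 - t) + 3 * t * d) * coord (f x) w + - (4 * t * d ^ 2)) s').
  - rewrite lsum_plus, lsum_scal, Hsum, lsum_const. unfold I01 in Ht.
    assert (d <= 1) by nra.
    assert (Hs4 : INR (length s') * (4 * t * d ^ 2) <= m * (4 * t * d ^ 2)).
    { apply Rmult_le_compat_r; [|exact Hl]. pose proof (pow2_ge_0 d). nra. }
    replace (m * (4 * t * d ^ 2)) with (4 * t * d * (d * m)) in Hs4 by ring.
    rewrite Hdm in Hs4. nra.
  - apply lsum_le. intros w _. unfold wt. unfold I01 in Ht.
    pose proof (coord_nonneg (f x) w). set (y := coord (f x) w) in *.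
    pose proof (Rmax_r 0 (y - d)).
    assert (t * (y * (y - d)) <= t * (y * Rmax 0 (y - d))).
    { apply Rmult_le_compat_l; [lra|]. apply Rmult_le_compat_l; lra. }
    assert (0 <= t * (y - 2 * d) ^ 2)
      by (apply Rmult_le_pos; [lra|apply pow2_ge_0]).
    nra.
Qed.

Lemma squeeze_ex : exists S, squeezes phi f d S.
Proof.
  assert (H : forall xt : point A * R, exists z : point A,
    I01 (snd xt) -> forall s, carried A (coord (fst xt)) s -> forall v,
      coord z v = coord (fst xt) v * wt d (snd xt) (coord (f (fst xt)) (phi v)) /
      lsum (fun u => coord (fst xt) u *
        wt d (snd xt) (coord (f (fst xt)) (phi u))) s).
  { intros [x t]. cbn [fst snd].
    destruct (excluded_middle_informative (I01 t)) as [Ht|Ht];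
      (* For times outside [0, 1] the value is an arbitrary default. *)
      [|exists x; contradiction].
    destruct (proj2_sig x) as [s Hs]. change (proj1_sig x) with (coord x) in Hs.
    pose proof (mass_ge x s t Ht Hs) as HM. pose proof d_pos as Hd.
    pose (p := fun v => coord x v * wt d t (coord (f x) (phi v))).
    fold p in HM.
    assert (Hp : supp_in p s).
    { intros v Hv. apply Hs. intros E. apply Hv. unfold p. rewrite E. ring. }
    assert (C : exists s', carried A (fun v => p v / lsum p s) s').
    { exists s. destruct Hs as (Hfs & Hnd & _). repeat split; auto.
      - intros v. apply Rle_mult_inv_pos; [|lra].
        apply Rmult_le_pos; auto using coord_nonneg, wt_nonneg.
      - intros v Hv. apply Hp. intros E. apply Hv. rewrite E. unfold Rdiv. ring.
      - rewrite (lsum_ext _ (fun v => / lsum p s * p v))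
          by (intros; unfold Rdiv; ring).
        rewrite lsum_scal. field. lra. }
    exists (exist (fun y => exists s, carried A y s) _ C). intros _ s' Hs' v. cbn. fold p.
    change (p v / lsum p s = p v / lsum p s'). f_equal.
    apply lsum_supp; try apply Hs; try apply Hs'; auto.
    intros w Hw. apply Hs'. intros E. apply Hw. unfold p. rewrite E. ring. }
  exists (fun x t =>
    proj1_sig (constructive_indefinite_description _ (H (x, t)))).
  intros x t s Ht Hs v.
  exact (proj2_sig (constructive_indefinite_description _ (H (x, t))) Ht s Hs v).
Qed.

Variable S : point A -> R -> point A.
Hypothesis HS : squeezes phi f d S.

Lemma squeeze_supp x t v : I01 t -> coord x v = 0 -> coord (S x t) v = 0.
Proof.
  intros Ht E. destruct (proj2_sig x) as [s Hs].
  rewrite (HS x t s Ht Hs), E. unfold Rdiv. ring.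
Qed.

Lemma squeeze_carried x t s : I01 t ->
  carried A (coord x) s -> carried A (coord (S x t)) s.
Proof.
  intros Ht (Hfs & Hnd & _ & Hs & _). apply carried_intro; auto.
  intros v Hv. apply Hs. intros E. apply Hv. now apply squeeze_supp.
Qed.

Lemma squeeze_small x v : coord (f x) (phi v) <= d -> coord (S x 1) v = 0.
Proof.
  intros H. destruct (proj2_sig x) as [s Hs].
  rewrite (HS x 1 s) by (unfold I01; auto; lra).
  rewrite wt_small by exact H. unfold Rdiv. ring.
Qed.

(** The normalizing mass is positive, so a zero comes from [coord x v] or from the weight, and at
    time 1 the weight is [c - d > 0] as soon as [c > d]. *)
Lemma squeeze_zero x v : coord (S x 1) v = 0 ->
  coord x v = 0 \/ coord (f x) (phi v) <= d.
Proof.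
  intros H. destruct (proj2_sig x) as [s Hs].
  change (proj1_sig x) with (coord x) in Hs.
  assert (I1 : I01 1) by (unfold I01; lra).
  rewrite (HS x 1 s I1 Hs) in H.
  pose proof (mass_ge x s 1 I1 Hs) as HM. pose proof d_pos as Hd.
  destruct (Rle_dec (coord (f x) (phi v)) d) as [Hle|Hgt]; [now right|left].
  apply Rmult_integral in H. destruct H as [H|H].
  - apply Rmult_integral in H. destruct H as [H|H]; [exact H|].
    unfold wt in H. rewrite Rmax_right in H by lra. lra.
  - assert (Hi := Rinv_0_lt_compat _ (Rlt_le_trans _ _ _ Hd HM)). lra.
Qed.

(** A coordinate below the threshold gets the least possible weight [1 - t], while the normalizing
    mass is an average of weights and so is at least [1 - t]. *)
Lemma squeeze_le x t v : I01 t ->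
  coord (f x) (phi v) <= d -> coord (S x t) v <= coord x v.
Proof.
  intros Ht H. destruct (proj2_sig x) as [s Hs].
  change (proj1_sig x) with (coord x) in Hs.
  rewrite (HS x t s Ht Hs), wt_small by exact H.
  pose proof (mass_ge x s t Ht Hs) as HM. pose proof d_pos as Hd.
  assert (HM' : 1 - t <= lsum (fun u => coord x u *
    wt d t (coord (f x) (phi u))) s).
  { destruct Hs as (_ & _ & _ & _ & Hsum).
    replace (1 - t) with ((1 - t) * lsum (coord x) s) by (rewrite Hsum; ring).
    rewrite <- lsum_scal.
    apply lsum_le. intros u _. rewrite Rmult_comm.
    apply Rmult_le_compat_l; auto using coord_nonneg, wt_ge. }
  set (M := lsum _ s) in *.
  apply Rmult_le_reg_r with M; [lra|]. unfold Rdiv.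
  rewrite Rmult_assoc, Rinv_l by lra. rewrite Rmult_1_r.
  apply Rmult_le_compat_l; auto using coord_nonneg.
Qed.

Lemma squeeze_homotopy : homotopy S (fun x => x) (fun x => S x 1).
Proof.
  split; [|split]; [| |reflexivity].
  - intros x t e Ht He.
    destruct (nearby_carried x) as (d0 & Hd0 & Hnear).
    destruct (proj2_sig x) as [s0 (Hf0 & Hnd0 & _)].
    assert (Hn0 : 0 <= n) by (pose proof (Hn _ Hf0 Hnd0);
      pose proof (pos_INR (length s0)); lra). clear s0 Hf0 Hnd0.
    pose proof d_pos as Hd.
    (* If coordinates and time move by at most [r], weights move by [(1 + n) * r], numerators by
       [(1 + (1 + n)) * r], and the mass by [n] times that. [L] adds the last two, [d] bounds the
       mass below, and the factor [n] in [C] comes from [edist_le]. *)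
    set (L := (1 + (1 + n)) + n * (1 + (1 + n))).
    assert (HL : 0 <= L) by (unfold L; nra).
    set (C := n * (L / d)).
    assert (HLd : 0 <= L / d) by (apply Rle_mult_inv_pos; lra).
    assert (HC : 0 <= C) by (apply Rmult_le_pos; auto).
    (* [C + 1] keeps the denominator positive and makes the final inequality strict. *)
    exists (Rmin d0 (e / (C + 1))).
    assert (Hr : 0 < Rmin d0 (e / (C + 1)))
      by (apply Rmin_glb_lt; [auto|apply Rdiv_lt_0_compat; lra]).
    split; [exact Hr|].
    intros y u Hu Hxy Htu. set (r := Rmin _ _) in *.
    assert (Hx0 : dist_lt A x y d0).
    { destruct Hxy as (l & Hl & Hlt). exists l. split; [exact Hl|].
      pose proof (Rmin_l d0 (e / (C + 1))). unfold r in Hlt. lra. }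
    destruct (proj2_sig y) as [s Hys]. change (proj1_sig y) with (coord y) in Hys.
    pose proof (Hnear y Hx0 s Hys) as Hxs.
    pose proof (Hn _ (proj1 Hys) (proj1 (proj2 Hys))) as Hlen.
    pose proof (pos_INR (length s)) as Hlen0.
    assert (Hcoord : forall v, Rabs (coord x v - coord y v) <= r)
      by (intros v; left; now apply coord_dist_lt).
    assert (Hfc : forall w, Rabs (coord (f x) w - coord (f y) w) <= n * r).
    { intros w. rewrite (Hf x s Hxs), (Hf y s Hys).
      eapply Rle_trans; [apply lsum_dist_le with (c := r)|nra].
      intros v _. rewrite <- Rmult_minus_distr_l, Rabs_mult.
      destruct (ind_cases phi w v) as [[_ ->]|[_ ->]].
      - rewrite Rabs_R1, Rmult_1_l. apply Hcoord.
      - rewrite Rabs_R0. lra. }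
    assert (Hwt : forall v, Rabs (wt d t (coord (f x) (phi v))
      - wt d u (coord (f y) (phi v))) <= r + n * r).
    { intros v. apply wt_lipschitz; auto; [lra| |lra].
      split; [apply coord_nonneg|apply coord_le1]. }
    assert (Hp : forall v, Rabs (coord x v * wt d t (coord (f x) (phi v))
      - coord y v * wt d u (coord (f y) (phi v))) <= r + (r + n * r)).
    { intros v. specialize (Hwt v). specialize (Hcoord v).
      set (a := wt d t (coord (f x) (phi v))) in *.
      set (b := wt d u (coord (f y) (phi v))) in *.
      assert (0 <= a <= 1).
      { split; [now apply wt_nonneg|]. apply wt_le1; auto using coord_le1. lra. }
      pose proof (coord_nonneg y v). pose proof (coord_le1 y v).
      replace (coord x v * a - coord y v * b)
        with ((coord x v - coord y v) * a + coord y v * (a - b)) by ring.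
      eapply Rle_trans; [apply Rabs_triang|]. rewrite !Rabs_mult.
      rewrite (Rabs_pos_eq a), (Rabs_pos_eq (coord y v)) by lra.
      pose proof (Rabs_pos (coord x v - coord y v)). pose proof (Rabs_pos (a - b)).
      apply Rplus_le_compat; nra. }
    apply carried_dist_lt with (s := s) (c := L / d * r); try apply Hys.
    + now apply squeeze_carried.
    + now apply squeeze_carried.
    + apply Rmult_le_pos; lra.
    + intros v. rewrite (HS x t s Ht Hxs), (HS y u s Hu Hys).
      replace (L / d * r) with (((r + (r + n * r)) + n * (r + (r + n * r))) / d)
        by (unfold L; field; lra).
      pose proof (mass_ge y s u Hu Hys) as HMy.
      assert (Hpy : forall v, 0 <= coord y v * wt d u (coord (f y) (phi v)))
        by (intros; apply Rmult_le_pos; auto using coord_nonneg, wt_nonneg).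
      apply quotient_dist; auto.
      * now apply mass_ge.
      * split; [apply Hpy|].
        destruct (Req_dec (coord y v) 0) as [E|E].
        -- rewrite E, Rmult_0_l. lra.
        -- apply (lsum_ge_term (fun v =>
             coord y v * wt d u (coord (f y) (phi v)))); auto. now apply Hys.
      * lra.
      * eapply Rle_trans; [apply lsum_dist_le; intros; apply Hp|].
        apply Rmult_le_compat_r; [nra|exact Hlen].
    + apply Rle_lt_trans with (C * r).
      * unfold C. rewrite Rmult_assoc. apply Rmult_le_compat_r; [|exact Hlen].
        apply Rmult_le_pos; lra.
      * apply Rle_lt_trans with (C * (e / (C + 1))).
        -- apply Rmult_le_compat_l; [exact HC|apply Rmin_r].
        -- apply Rmult_lt_reg_r with (C + 1); [lra|].
           replace (C * (e / (C + 1)) * (C + 1)) with (C * e) by (field; lra). lra.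
  - intros x. apply point_ext. intros v. destruct (proj2_sig x) as [s Hs].
    change (proj1_sig x) with (coord x) in Hs.
    assert (W : forall c, wt d 0 c = 1) by (intros; unfold wt; ring).
    rewrite (HS x 0 s) by (unfold I01; auto; lra).
    rewrite W, (lsum_ext _ (coord x)) by (intros; rewrite W; ring).
    destruct Hs as (_ & _ & _ & _ & ->). field.
Qed.

(* Squeezing is natural: [f] sends all of the fibre of [phi] over [w] to the
   same weight, so rescaling upstairs covers rescaling downstairs. *)
Lemma squeeze_lift (T : point B -> R -> point B) :
  squeezes (fun w => w) (fun y => y) d T ->
  forall x t, I01 t -> f (S x t) = T (f x) t.
Proof.
  intros HT x t Ht. apply point_ext. intros w.
  destruct (proj2_sig x) as [s Hs]. change (proj1_sig x) with (coord x) in Hs.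
  destruct (proj2_sig (f x)) as [s' Hs'].
  change (proj1_sig (f x)) with (coord (f x)) in Hs'.
  rewrite (HT (f x) t s' Ht Hs').
  rewrite <- (lsum_push x s s' (fun w => wt d t (coord (f x) w)) Hs Hs').
  rewrite (Hf (S x t) s (squeeze_carried x t s Ht Hs)).
  set (M := lsum (fun v => coord x v * wt d t (coord (f x) (phi v))) s).
  rewrite (lsum_ext _ (fun v =>
    wt d t (coord (f x) w) / M * (ind phi w v * coord x v))).
  - rewrite lsum_scal, <- (Hf x s Hs). unfold Rdiv. ring.
  - intros v _. rewrite (HS x t s Ht Hs). fold M.
    destruct (ind_cases phi w v) as [[E ->]|[_ ->]]; [rewrite E|];
      unfold Rdiv; ring.
Qed.
End Squeeze.

(** * Assembling the triangular homotopy equivalence *)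

Lemma finite_dim_bound {V} (K : complex V) : finite_dim K ->
  exists n, 1 <= n /\ forall s, face K s -> NoDup s -> INR (length s) <= n.
Proof.
  (* The successor keeps the bound at least 1, so that [/ (2 * m)] is a positive threshold. *)
  intros (n & Hn). exists (INR (S n)). split.
  - rewrite S_INR. pose proof (pos_INR n). lra.
  - intros s Hf Hnd. apply le_INR. specialize (Hn s Hf Hnd). lia.
Qed.

(** Being in an open simplex fixes the support exactly, so triangularity only asks that vanishing
    coordinates stay zero. *)
Lemma htriangular_intro {VA VB VY} {A : complex VA} {B : complex VB}
  {Y : complex VY} (p : point A -> point Y) (q : point B -> point Y) H :
  (forall a t, I01 t -> forall v, coord (p a) v = 0 -> coord (q (H a t)) v = 0) ->
  htriangular p q H.
Proof.
  intros HH s _ _ a t Ht Ho v Hv. apply Ho. intros E. apply Hv. now apply HH.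
Qed.

Theorem theorem3p1 (VX VY : Type) (X : complex VX) (Y : complex VY)
  (hXd : finite_dim X) (hXl : locally_finite X)
  (hYd : finite_dim Y) (hYl : locally_finite Y) :
  exists eps0 : R, 0 < eps0 /\
    forall eps : R, 0 < eps -> eps < eps0 ->
    forall f : point X -> point Y,
      simplicial f ->
      controlled_he Y f (fun y => y) f eps ->
      exists f' : point X -> point Y,
        homotopic f f' /\ triangular_he Y f' (fun y => y) f'.
Proof.
  destruct (finite_dim_bound X hXd) as (n & _ & Hn).
  destruct (finite_dim_bound Y hYd) as (m & m_ge1 & Hm).
  exists (/ (2 * m)). split; [apply Rinv_0_lt_compat; lra|].
  intros eps _ Heps f (phi & _ & Hf)
    (Cf & g & h1 & h2 & Cg & Hh1 & Hh2 & _ & Kg & Kh1 & Kh2).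
  fold (simplicial_via phi f) in Hf.
  destruct (squeeze_ex phi f Hf m Hm m_ge1) as (S & HS).
  destruct (squeeze_ex _ _ (simplicial_via_id Y) m Hm m_ge1) as (T & HT).
  pose proof (squeeze_homotopy _ _ Hf n m Hn Hm m_ge1 S HS) as HomS.
  pose proof (squeeze_homotopy _ _ (simplicial_via_id Y) m m Hm Hm m_ge1 T HT)
    as HomT.
  pose proof (homotopy_end _ _ _ HomS) as CS.
  pose proof (homotopy_end _ _ _ HomT) as CT.
  pose proof (squeeze_lift _ _ Hf m S HS T HT) as Lift.
  assert (I1 : I01 1) by (unfold I01; lra).
  assert (Irev : forall t, I01 t -> I01 (1 - t)) by (unfold I01; intros; lra).
  assert (Tsmall : forall y v, coord y v <= / (2 * m) -> coord (T y 1) v = 0)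
    by (intros y v; apply (squeeze_small _ _ m T HT)).
  (* Since [eps] is below the threshold, a coordinate vanishing at [y] is still below the threshold
     at [z], and [T] at time 1 kills it. *)
  assert (Tnear : forall y z v, dist_lt Y y z eps -> coord y v = 0 ->
    coord (T z 1) v = 0).
  { intros y z v Hd E. apply Tsmall. pose proof (coord_dist_lt _ _ _ v Hd) as Hv.
    rewrite E in Hv. apply Rabs_def2 in Hv. lra. }
  assert (Tzero : forall y v, coord (T y 1) v = 0 -> coord y v <= / (2 * m)).
  { intros y v E.
    destruct (squeeze_zero _ _ (simplicial_via_id Y) m Hm m_ge1 T HT y v E)
      as [E'|E']; [|exact E'].
    rewrite E'. left. apply Rinv_0_lt_compat. lra. }
  assert (Tsupp : forall y t v, I01 t -> coord y v = 0 -> coord (T y t) v = 0)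
    by (intros; now apply (squeeze_supp _ _ m T HT)).
  exists (fun x => T (f x) 1). split.
  { exists (fun x t => T (f x) t). exact (homotopy_precomp _ _ _ _ HomT Cf). }
  split; [exact (continuous_comp _ _ Cf CT)|].
  exists g, (concat (fun y t => T (h1 y t) 1) (fun y t => T y (1 - t))),
    (concat (fun x t => h2 (S x 1) t) (fun x t => S x (1 - t))).
  split; [exact Cg|]. split; [|split; [|split; [|split; [|split]]]].
  - exact (homotopy_concat _ _ _ _ _ (homotopy_postcomp _ _ _ _ Hh1 CT)
      (homotopy_rev _ _ _ HomT)).
  - apply homotopy_concat with (fun x => S x 1).
    + replace (fun a => g (T (f a) 1)) with (fun a => g (f (S a 1)))
        by (apply functional_extensionality; intros a; now rewrite Lift).
      exact (homotopy_precomp _ _ _ _ Hh2 CS).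
    + exact (homotopy_rev _ _ _ HomS).
  (* The control map of the source is [f'] itself, so the open simplex of [x] already contains the
     support of its image. *)
  - intros s _ _ x Ho v Hv. now apply Ho.
  - intros s _ _ y Ho v Hv. apply Ho. intros E. apply Hv. exact (Tnear _ _ _ (Kg y) E).
  - apply htriangular_intro.
    apply (concat_ind (fun y z => forall v, coord y v = 0 -> coord z v = 0)).
    + intros y t Ht v. apply Tnear. now apply Kh1.
    + intros y t Ht v. apply Tsupp. auto.
  - apply htriangular_intro.
    apply (concat_ind (fun x z => forall v,
      coord (T (f x) 1) v = 0 -> coord (T (f z) 1) v = 0)).
    (* [h2] moves [f (S x 1)], which is [T (f x) 1] by [Lift], by less than [eps]. *)
    + intros x t Ht v E. apply (Tnear _ _ v (Kh2 (S x 1) t Ht)).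
      now rewrite Lift.
    (* A coordinate killed in [T (f x) 1] was below the threshold in [f x]. Squeezing to time
       [1 - t] does not raise it, so the outer [T] at time 1 kills it again. *)
    + intros x t Ht v E. rewrite Lift by auto. apply Tsmall.
      eapply Rle_trans; [|exact (Tzero _ _ E)].
      apply (squeeze_le _ _ (simplicial_via_id Y) m Hm m_ge1 T HT); auto.
Qed.
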